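(* In the Euler graph with root $R=(0,0)$, for each vertex $P$ the limit $$\lim_{n\to\infty}\frac{\dim(P,(i_n,j_n))}{\dim(R,(i_n,j_n))}$$ exists for every infinite path from $R$, with successive vertices $(i_n,j_n)$, $n\ge 0$, for which $i_n$ and $j_n$ are both unbounded. Moreover, this limit is constant as $P$ varies over the vertices at any fixed level.
   Context: The Euler graph is the infinite directed multigraph with vertex set $\{(i,j): i,j\in\mathbb{Z}_{\ge 0}\}$, having exactly $j+1$ edges from $(i,j)$ to $(i+1,j)$ and exactly $i+1$ edges from $(i,j)$ to $(i,j+1)$, and no other edges. The level of the vertex $(i,j)$ is $i+j$; the root is $R=(0,0)$. A path is a sequence of consecutive directed edges (parallel edges are distinguished). For vertices $P,Q$, $\dim(P,Q)$ denotes the number of directed paths from $P$ to $Q$. For an infinite path starting at $R$, $(i_n,j_n)$ denotes its vertex at level $n$, so $i_n+j_n=n$. *)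

(* Defs.v *)
From mathcomp Require Import all_boot all_order all_algebra finmap.
From mathcomp Require Import all_classical all_reals all_analysis.

Set Implicit Arguments.
Unset Strict Implicit.
Unset Printing Implicit Defensive.

Import Order.TTheory GRing.Theory Num.Theory.
Import numFieldNormedType.Exports.

Local Open Scope classical_set_scope.
Local Open Scope fset_scope.
Local Open Scope nat_scope.

Definition vertex : Type := (nat * nat)%type.

Definition level (v : vertex) : nat := v.1 + v.2.

Definition graph_root : vertex := (0, 0).

(* The number of edges from [u] to [v]. *)
Definition mult (u v : vertex) : nat :=
  if v == (u.1.+1, u.2) then u.2.+1
  else if v == (u.1, u.2.+1) then u.1.+1
  else 0.

(* A triple (u, v, k) encodes the k-th of the parallel edges from [u] to [v];
   it is an edge of the Euler graph only when [k < mult u v]. *)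
Definition arrow : Type := (vertex * vertex * nat)%type.

Definition src (e : arrow) : vertex := e.1.1.
Definition tgt (e : arrow) : vertex := e.1.2.
Definition is_edge (e : arrow) : bool := e.2 < mult (src e) (tgt e).

(* The empty sequence is the unique path of length 0 from a vertex to
   itself. *)
Fixpoint is_path (P Q : vertex) (p : seq arrow) : bool :=
  if p is e :: p' then [&& is_edge e, src e == P & is_path (tgt e) Q p']
  else P == Q.

Definition paths (P Q : vertex) : set (seq arrow) := [set p | is_path P Q p].

Lemma mult_level (u v : vertex) : 0 < mult u v -> level v = (level u).+1.
Proof.
rewrite /mult /level; case: eqP => [-> /= _|_]; first by rewrite addSn.
by case: eqP => [-> /= _|//]; rewrite addnS.
Qed.

Lemma is_path_size (p : seq arrow) (P Q : vertex) :
  is_path P Q p -> size p + level P = level Q.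
Proof.
elim: p P => [|e p IHp] P /=; first by move/eqP->.
case/and3P=> e_edge /eqP <- /IHp <-.
by rewrite (mult_level (leq_ltn_trans (leq0n _) e_edge)) addnS addSn.
Qed.

(* [fset_set] sends infinite sets to [fset0], so this finiteness is what makes
   [dim] below the actual number of paths. *)
Lemma finite_paths (P Q : vertex) : finite_set (paths P Q).
Proof.
pose out (u : vertex) : seq arrow :=
  [seq (u, (u.1.+1, u.2), k) | k <- iota 0 u.2.+1] ++
  [seq (u, (u.1, u.2.+1), k) | k <- iota 0 u.1.+1].
have outP e : is_edge e -> e \in out (src e).
  case: e => [[u v] k]; rewrite /is_edge /mult /src /tgt /= mem_cat.
  case: eqP => [-> lt_k|_]; first by rewrite map_f // mem_iota.
  case: eqP => [-> lt_k|//].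
  by rewrite (map_f (fun k => (_, k)) (x := k)) ?orbT // mem_iota.
pose fix walks n u {struct n} : seq (seq arrow) :=
  if n is m.+1 then [seq e :: p | e <- out u, p <- walks m (tgt e)]
  else [:: [::]].
have walksP p u : is_path u Q p -> p \in walks (size p) u.
  elim: p u => [|e p IHp] u; first by rewrite inE.
  case/and3P=> e_edge /eqP <- /IHp p_in.
  by apply: (allpairs_f_dep cons) => //; apply: outP.
apply: (@sub_finite_set _ _ [set` walks (level Q - level P) P]);
  last exact: finite_seq.
move=> p /= pP; have <- : size p = level Q - level P.
  by rewrite -(is_path_size pP) addnK.
exact: walksP.
Qed.

Definition dim (P Q : vertex) : nat := #|` fset_set (paths P Q)|.

(* [e n] is the n-th edge of the path, so [src (e n)] is its vertex at level
   n. *)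
Definition infinite_path (e : nat -> arrow) : Prop :=
  [/\ src (e 0) = graph_root,
      forall n, is_edge (e n)
    & forall n, src (e n.+1) = tgt (e n)].

Lemma level_infinite_path (e : nat -> arrow) (n : nat) :
  infinite_path e -> level (src (e n)) = n.
Proof.
case=> e0 e_edge eS; elim: n => [|n IHn]; first by rewrite e0.
by rewrite eS (mult_level (leq_ltn_trans (leq0n _) (e_edge n))) IHn.
Qed.

Definition unbounded (u : nat -> nat) : Prop := forall M, exists n, M < u n.

Local Open Scope ring_scope.

Definition dim_ratio (R : realType) (P : vertex) (e : nat -> arrow) :
    R ^nat :=
  fun n => (dim P (src (e n)))%:R / (dim graph_root (src (e n)))%:R.

(* Main.v *)
Require Import Defs.
From mathcomp Require Import all_boot all_order all_algebra finmap.
From mathcomp Require Import all_classical all_reals all_analysis.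
From mathcomp Require Import zify.

Import Order.TTheory GRing.Theory Num.Theory.
Import numFieldNormedType.Exports.

Local Open Scope classical_set_scope.
Local Open Scope nat_scope.

(** Write [D P Q] for [dim P Q].  The ratio in the theorem is controlled by
    comparing two neighbouring vertices [P = (a, b.+1)] and [P' = (a.+1, b)] of
    one level.  Both [D P] and [D P'] obey the recurrence
    [D (i, j) = (j + 1) D (i - 1, j) + (i + 1) D (i, j - 1)] above that level
    ([dim_last_edge]), and two facts about it suffice.

    Monotonicity: along each level, [D P / D P'] is nondecreasing in [j].  It
    holds at the level of [P] and [P'], and the recurrence has nonnegative
    coefficients and moves mass to adjacent positions only, hence preserves
    this order ([dim_likelihood_ratio]).

    A weighted sum in closed form: for every [k], the sum of
    [D (a, b) (i, j) C(k + i + 1, N + 1)] over the vertices [(i, j)] of level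
    [N] is [(k + 1) ^ (N - a - b) C(k + a + 1, a + b + 1)] ([worpitzky]).  This
    extends Worpitzky's identity for the Eulerian numbers, which is the case
    [a = b = 0].  The weights vanish for [j > k].

    Take [k = j].  The quotient of the two closed forms for [P] and [P'] is
    [(j - b) / (j + a + 2)], and it is an average of the values of [D P / D P']
    at the positions up to [j], so it is at most the last and largest of them,
    the value at [(i, j)].  Exchanging the two coordinates gives an upper bound:
    [(j - b) / (j + a + 2) <= D P (i, j) / D P' (i, j) <= (i + b + 2) / (i - a)].
    Both bounds tend to 1 when [i] and [j] tend to infinity, so any two vertices
    of one level have asymptotically the same number of paths to [(i, j)].
    Finally [D R Q] is the sum of [D R V * D V Q] over the vertices [V] of the
    level of [P] ([dim_via_level]); dividing by [D P Q], the limit of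
    [D P Q / D R Q] is the inverse of the number of paths from the root to that
    level, which depends on the level of [P] alone. *)

Local Notation dim := Defs.dim.

(** * Counting paths by their last edge *)

Lemma is_path_rcons P Q (p : seq arrow) e :
  is_path P Q (rcons p e) = [&& is_path P (src e) p, is_edge e & tgt e == Q].
Proof.
elim: p P => [|f p IHp] P /=; last by rewrite IHp -!andbA.
by rewrite (eq_sym P) andbCA.
Qed.

Lemma mem_paths P Q (p : seq arrow) :
  (p \in fset_set (paths P Q)) = is_path P Q p.
Proof.
rewrite in_fset_set; last exact: finite_paths.
by apply/idP/idP => [/set_mem|?]; last apply: mem_set.
Qed.

Lemma dim_size P Q (s : seq (seq arrow)) :
  uniq s -> (forall p, (p \in s) = is_path P Q p) -> dim P Q = size s.
Proof.
move=> s_uniq sP; rewrite /dim; apply/perm_size/uniq_perm => // p.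
by rewrite sP -mem_paths.
Qed.

(** The adjacency operator of the Euler graph, acting on functions of the
    vertices by summation over incoming edges. *)
Definition inflow (f : vertex -> nat) (Q : vertex) : nat :=
  (if Q.1 is i.+1 then Q.2.+1 * f (i, Q.2) else 0) +
  (if Q.2 is j.+1 then Q.1.+1 * f (Q.1, j) else 0).

(** Removing the last edge splits the nonempty paths to [Q] according to the
    predecessor of [Q] through which they arrive and to the parallel edge
    used. *)
Lemma dim_last_edge P Q : P != Q -> dim P Q = inflow (dim P) Q.
Proof.
move=> neqPQ.
pose via (u : vertex) (m : nat) : seq (seq arrow) :=
  [seq rcons p (u, Q, k) | p <- fset_set (paths P u), k <- iota 0 m].
have via_uniq u m : uniq (via u m).
  apply: allpairs_uniq; [exact: fset_uniq|exact: iota_uniq|].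
  by move=> [p k] [p' k'] _ _ /= /rcons_inj[-> ->].
have size_via u m : size (via u m) = m * dim P u.
  by rewrite size_allpairs size_iota mulnC.
have viaP u m p (e : arrow) : (rcons p e \in via u m) =
    [&& is_path P (src e) p, src e == u, tgt e == Q & e.2 < m].
  apply/allpairsP/idP => [[[p' k] /= [+ + /rcons_inj[-> ->]]]|].
    by rewrite mem_paths mem_iota add0n /src /tgt /= !eqxx => -> ->.
  case: e => [[u' v] k] /and4P[+ /eqP + /eqP].
  rewrite /src /tgt /= => + <- -> lt_k.
  by move=> pP; exists (p, k); rewrite /= mem_paths pP mem_iota.
have nil_via u m : ([::] \in via u m) = false.
  by apply/negP => /allpairsP[[p k] [_ _]] /(congr1 size); rewrite size_rcons.
pose vias := (if Q.1 is i.+1 then via (i, Q.2) Q.2.+1 else [::]) ++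
             (if Q.2 is j.+1 then via (Q.1, j) Q.1.+1 else [::]).
have <- : size vias = inflow (dim P) Q.
  by rewrite size_cat /inflow; case: Q.1 Q.2 => [|i] [|j]; rewrite ?size_via.
apply: dim_size.
  rewrite cat_uniq; apply/and3P; split; try by [case: Q.1 | case: Q.2].
  apply/hasPn => p; case: Q.1 Q.2 => [|i] [|j] //.
  case/lastP: p => [|p e]; rewrite ?nil_via //= !viaP => /and4P[_ /eqP -> _ _].
  by apply/negP => /and4P[_ /eqP[]]; lia.
move=> p; case/lastP: p => [|p e].
  rewrite /= (negbTE neqPQ) mem_cat.
  by case: Q.1 Q.2 => [|i] [|j]; rewrite ?nil_via ?in_nil.
rewrite is_path_rcons mem_cat.
case: e viaP => [[[a b] v] k]; rewrite /is_edge /src /tgt /= => viaP.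
case pP: (is_path P (a, b) p); last first.
  by case: Q.1 Q.2 => [|i] [|j]; rewrite ?viaP /src ?pP ?in_nil.
case: (eqVneq v Q) => [->|neqv]; rewrite ?(negbTE neqv) ?andbF /=; last first.
  by case: Q.1 Q.2 => [|i] [|j]; rewrite ?viaP /src /tgt /= ?(negbTE neqv) ?andbF.
rewrite andbT.
move: via viaP {via_uniq size_via nil_via vias neqPQ}.
case: Q => i j via viaP; rewrite /mult.
case: i j viaP => [|i] [|j] viaP /=;
  rewrite ?viaP /src /tgt /= ?pP ?eqxx ?in_nil /= ?xpair_eqE;
  do ?case: ifP => ?; lia.
Qed.

Lemma dim_refl P : dim P P = 1.
Proof.
rewrite (@dim_size P P [:: [::]]) // => -[|e p]; first by rewrite inE /= eqxx.
by apply/idP/idP => // /is_path_size /=; lia.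
Qed.

Lemma dim_eq0 P Q : level Q <= level P -> P != Q -> dim P Q = 0.
Proof.
move=> leQP /negbTE neqPQ; rewrite (@dim_size P Q [::]) // => -[|e p].
  by rewrite in_nil /= neqPQ.
by apply/idP/idP => // /is_path_size /=; lia.
Qed.

Lemma dim_gt0 a b c d : 0 < dim (a, b) (a + c, b + d).
Proof.
elim: d => [|d IHd].
  rewrite addn0; elim: c => [|c IHc]; first by rewrite addn0 dim_refl.
  rewrite dim_last_edge; last by rewrite xpair_eqE; lia.
  by rewrite /inflow /= addnS; nia.
rewrite dim_last_edge; last by rewrite xpair_eqE; lia.
by rewrite /inflow /= addnS; nia.
Qed.

(** Exchanging the coordinates is an automorphism of the Euler graph. *)
Lemma dim_sym a b i j : dim (a, b) (i, j) = dim (b, a) (j, i).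
Proof.
have [N] := ubnP (i + j); elim: N i j => // N IHN i j ltN.
have [[<- <-]|neq] := eqVneq (a, b) (i, j); first by rewrite !dim_refl.
rewrite !dim_last_edge //; last by rewrite xpair_eqE andbC -xpair_eqE.
rewrite /inflow /=; case: i j ltN {neq} => [|i] [|j] ltN //=.
- by rewrite addnC IHN.
- by rewrite addnC IHN //; lia.
- by rewrite addnC !(IHN _ _ _) //; lia.
Qed.

(** * Monotonicity of the ratio along a level *)

(** Cross-multiplied form, which also covers vanishing counts, of: the ratio of
    the counts from [(a, b.+1)] and from [(a.+1, b)] is nondecreasing in the
    second coordinate.  In the induction, a predecessor of [(i, j)] never lies
    on the far side of a predecessor of [(i', j')] as soon as [j < j'], so each
    of the four products of terms of the recurrence is an instance of the
    statement one level below. *)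
Lemma dim_likelihood_ratio a b i j i' j' :
  i + j = i' + j' -> j <= j' ->
  dim (a, b.+1) (i, j) * dim (a.+1, b) (i', j') <=
  dim (a.+1, b) (i, j) * dim (a, b.+1) (i', j').
Proof.
have [N] := ubnP (i + j); elim: N i j i' j' => // N IHN i j i' j' ltN eqN lejj'.
case: (ltngtP j j') lejj' => // [ltjj' _|eqj _]; last first.
  have -> : i' = i by lia.
  by rewrite eqj mulnC.
have [leN|gtN] := leqP (i + j) (a + b).+1.
  have [[_ ej]|neq1] := eqVneq (a, b.+1) (i, j).
    by rewrite [X in _ * X]dim_eq0 ?muln0 //= /level ?xpair_eqE /=; lia.
  by rewrite dim_eq0 //= /level /=; lia.
rewrite !dim_last_edge ?xpair_eqE; try lia.
rewrite /inflow /=.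
(* As [j < j'] on one level, both [i] and [j'] are positive. *)
case: i j' eqN ltN ltjj' gtN => [|i] [|j'] eqN ltN ltjj' gtN; try lia.
have IHlevel k l k' l' : k + l = i + j -> k + l = k' + l' -> l <= l' ->
  dim (a, b.+1) (k, l) * dim (a.+1, b) (k', l') <=
  dim (a.+1, b) (k, l) * dim (a, b.+1) (k', l').
  by move=> ekl *; apply: IHN => //; lia.
have mulACA m n x y z t : x * y <= z * t -> m * x * (n * y) <= m * z * (n * t).
  by move=> le; rewrite mulnACA [leqRHS]mulnACA leq_mul2l le orbT.
have cross_add x1 x2 y1 y2 z1 z2 t1 t2 :
    x1 * y1 <= z1 * t1 -> x1 * y2 <= z1 * t2 -> x2 * y1 <= z2 * t1 ->
    x2 * y2 <= z2 * t2 -> (x1 + x2) * (y1 + y2) <= (z1 + z2) * (t1 + t2).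
  by move=> *; rewrite !mulnDl !mulnDr !leq_add.
apply: cross_add;
  case: i' j eqN {ltN} ltjj' gtN IHlevel => [|i'] [|j] eqN ltjj' gtN IHlevel;
  rewrite ?(mul0n, muln0) //; apply: mulACA; apply: IHlevel; lia.
Qed.

(** * Weighted sums over a level *)

(** Summation by parts: summing over the edges between two levels grouped by
    their target or by their source. *)
Lemma sum_level_inflow (f h : vertex -> nat) (N : nat) :
  \sum_(j < N.+2) inflow f (N.+1 - j, nat_of_ord j) * h (N.+1 - j, nat_of_ord j) =
  \sum_(j < N.+1) f (N - j, nat_of_ord j) *
    (j.+1 * h ((N - j).+1, nat_of_ord j) + (N - j).+1 * h (N - j, j.+1)).
Proof.
under eq_bigr do rewrite /inflow /= mulnDl.
rewrite big_split /= big_ord_recr /= subnn mul0n addn0.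
rewrite [X in _ + X]big_ord_recl /= add0n -big_split /=.
apply: eq_bigr => j _; rewrite /bump /= add1n subSS subSn //=; last first.
  by rewrite -ltnS.
by rewrite mulnDr; congr (_ + _); rewrite mulnCA mulnA.
Qed.

Lemma sum_level_dim P (h : vertex -> nat) (N : nat) : level P <= N ->
  \sum_(j < N.+2) dim P (N.+1 - j, nat_of_ord j) * h (N.+1 - j, nat_of_ord j) =
  \sum_(j < N.+1) dim P (N - j, nat_of_ord j) *
    (j.+1 * h ((N - j).+1, nat_of_ord j) + (N - j).+1 * h (N - j, j.+1)).
Proof.
move=> leN; rewrite -sum_level_inflow; apply: eq_bigr => j _.
rewrite dim_last_edge //; apply: contraTneq leN => ->.
by have := ltn_ord j; rewrite /level /=; lia.
Qed.

Lemma sum_level_refl P (h : vertex -> nat) :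
  \sum_(j < (level P).+1)
     dim P (level P - j, nat_of_ord j) * h (level P - j, nat_of_ord j) = h P.
Proof.
case: P => a b; rewrite /level /=.
have ltb : b < (a + b).+1 by lia.
rewrite (bigD1 (Ordinal ltb)) //= addnK dim_refl mul1n big1 ?addn0 // => j neqj.
rewrite dim_eq0 //; first by have := ltn_ord j; rewrite /level /=; lia.
by apply: contraNneq neqj => -[_ eqb]; apply/eqP/val_inj.
Qed.

(** The weight [h (i, j) = C(k + i + 1, i + j + 1)] is an eigenfunction of the
    adjacency operator seen from the source side:
    [(j + 1) h (i + 1, j) + (i + 1) h (i, j + 1) = (k + 1) h (i, j)].  Hence the
    weighted sum is multiplied by [k + 1] at each level. *)
Lemma worpitzky a b k m :
  \sum_(j < (m + (a + b)).+1) dim (a, b) (m + (a + b) - j, nat_of_ord j) *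
     'C((k + (m + (a + b) - j)).+1, (m + (a + b)).+1) =
  k.+1 ^ m * 'C((k + a).+1, (a + b).+1).
Proof.
elim: m => [|m IHm].
  rewrite mul1n.
  exact: (sum_level_refl (a, b) (fun Q : vertex => 'C((k + Q.1).+1, (a + b).+1))).
rewrite expnS -mulnA -IHm addSn; set N := m + (a + b).
rewrite (sum_level_dim _ (fun Q : vertex => 'C((k + Q.1).+1, N.+2))); last first.
  by rewrite /level /= leq_addl.
rewrite big_distrr; apply: eq_bigr => j _ /=; rewrite mulnCA; congr (_ * _).
have [i def_i] : {i | N - j = i} by exists (N - j).
have ltj := ltn_ord j; rewrite -/N def_i; have eN : N = i + j by lia.
rewrite addnS binS.
have := mul_bin_left (k + i).+1 N.+1.
(* For [j > k] the binomial coefficients on both sides vanish. *)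
have [lejk|ltkj] := leqP j k; last by rewrite !bin_small //; lia.
have -> : (k + i).+1 - N.+1 = k - j by lia.
move: ('C(_, N.+2)) ('C(_, N.+1)) => c2 c1 h.
nia.
Qed.

(** The ratio at [(i, j)] is at least the average of the ratios at the positions
    [l <= j] of its level, with the weights of [worpitzky] for [k = j]; this
    average is a quotient of two binomial coefficients, equal to
    [(j - b) / (j + a + 2)]. *)
Lemma dim_neighbour_ratio a b i j : a + b < i + j ->
  (j - b) * dim (a.+1, b) (i, j) <= (j + a).+2 * dim (a, b.+1) (i, j).
Proof.
move=> ltN; have [lejb|ltbj] := leqP j b.
  by move: lejb; rewrite -subn_eq0 => /eqP->; rewrite mul0n.
set D' := dim (a.+1, b) _; set D := dim (a, b.+1) _.
pose m := i + j - (a + b).+1.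
have eN : i + j = m + (a.+1 + b) by lia.
have eN' : i + j = m + (a + b.+1) by lia.
have := worpitzky a b.+1 j m; have := worpitzky a.+1 b j m.
rewrite -eN -eN' [a + b.+1]addnS [a.+1 + b]addSn [j + a.+1]addnS => W' W.
have : j.+1 ^ m * 'C((j + a).+1, (a + b).+2) * D' <=
       j.+1 ^ m * 'C((j + a).+2, (a + b).+2) * D.
  rewrite -W -W' !big_distrl; apply: leq_sum => l _ /=.
  have ltl := ltn_ord l.
  have [lelj|ltjl] := leqP l j; last by rewrite bin_small ?muln0 ?mul0n //; lia.
  rewrite mulnAC [leqRHS]mulnAC leq_mul2r dim_likelihood_ratio ?orbT //; lia.
rewrite -!mulnA leq_pmul2l ?expn_gt0 // => le1.
have C_gt0 : 0 < 'C((j + a).+2, (a + b).+2) by rewrite bin_gt0; lia.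
have eC := mul_bin_down (j + a).+2 (a + b).+2.
have -> : j - b = (j + a).+2 - (a + b).+2 by lia.
rewrite -(leq_pmul2l C_gt0) mulnA [_ * (_ - _)]mulnC -eC /= -mulnA.
by rewrite [leqRHS]mulnCA leq_pmul2l.
Qed.

(** Each path from [P] to [Q] crosses the level [n] at exactly one vertex.  The
    induction on the level of [Q] uses that both sides satisfy the recurrence of
    [dim_last_edge] in [Q] above the level [n]. *)
Lemma dim_via_level P Q n : level P <= n <= level Q ->
  dim P Q = \sum_(c < n.+1) dim P (n - c, nat_of_ord c) * dim (n - c, nat_of_ord c) Q.
Proof.
case: Q => i j; rewrite /level /= => /andP[leP].
have [N] := ubnP (i + j); elim: N i j => // N IHN i j ltN.
rewrite leq_eqVlt => /orP[/eqP eqn|ltn].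
  have ltj : j < (i + j).+1 by lia.
  rewrite eqn (bigD1 (Ordinal ltj)) //= addnK dim_refl muln1.
  rewrite big1 ?addn0 // => c neqc.
  rewrite [X in _ * X]dim_eq0 ?muln0 //.
    by have := ltn_ord c; rewrite /level /=; lia.
  by apply: contraNneq neqc => -[_ eqc]; apply/eqP/val_inj.
rewrite dim_last_edge; last first.
  by apply: contraTneq leP => ->; rewrite /=; lia.
under eq_bigr => c _.
  rewrite [X in _ * X]dim_last_edge; last first.
    by apply: contraTneq ltn => -[<- <-]; have := ltn_ord c; lia.
  rewrite /inflow /= mulnDr.
  over.
rewrite big_split /inflow /=; congr (_ + _).
  case: i ltN ltn => [|i] ltN ltn; first by rewrite big1 // => c _; rewrite muln0.
  rewrite IHN; try lia; rewrite big_distrr.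
  by apply: eq_bigr => c _; rewrite mulnCA.
case: j ltN ltn => [|j] ltN ltn; first by rewrite big1 // => c _; rewrite muln0.
rewrite IHN; try lia; rewrite big_distrr.
by apply: eq_bigr => c _; rewrite mulnCA.
Qed.

(** * Limits along a sequence of vertices with both coordinates unbounded *)

Local Open Scope ring_scope.

Lemma cvg_shifted_quotient (R : realType) (u : nat -> nat) (a b : nat) :
  u n @[n --> \oo] --> \oo ->
  (u n - b)%N%:R / (u n + a).+2%:R @[n --> \oo] --> (1 : R).
Proof.
move=> uoo.
have inv0 : ((u n + a).+2%:R : R)^-1 @[n --> \oo] --> 0.
  apply/gtr0_cvgV0; first by apply: nearW => n; rewrite ltr0n.
  apply/cvgrnyP/cvgnyPge => A.
  move/cvgnyPge : uoo => /(_ A); apply: filterS => n; lia.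
have : 1 - (a + b).+2%:R / (u n + a).+2%:R @[n --> \oo] --> (1 : R).
  rewrite -[X in _ --> X]subr0 -(mulr0 (a + b).+2%:R).
  by apply: cvgB; [exact: cvg_cst|exact: cvgMl_tmp].
apply: cvg_trans; apply: near_eq_cvg; move/cvgnyPge : uoo => /(_ b).
apply: filterS => n leb.
apply: (mulIf (x := (u n + a).+2%:R)); first by rewrite pnatr_eq0.
rewrite mulrBl -mulrA !mulVf ?divfK ?pnatr_eq0 // mulr1 mul1r.
rewrite -natrB; last by lia.
by congr (_%:R); lia.
Qed.

Lemma near_dim_gt0 (q : nat -> vertex)
    (q1 : (q n).1 @[n --> \oo] --> \oo) (q2 : (q n).2 @[n --> \oo] --> \oo) P :
  \forall n \near \oo, (0 < dim P (q n))%N.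
Proof.
case: P => a b; move/cvgnyPge : q1 => /(_ a); move/cvgnyPge : q2 => /(_ b).
apply: filterS2 => n leb lea; have := dim_gt0 a b ((q n).1 - a) ((q n).2 - b).
by rewrite !subnKC // -surjective_pairing.
Qed.

(** The lower bound of the squeeze is [dim_neighbour_ratio], and the upper bound
    is its mirror image under [dim_sym]. *)
Lemma cvg_neighbour_ratio (R : realType) (q : nat -> vertex)
    (q1 : (q n).1 @[n --> \oo] --> \oo) (q2 : (q n).2 @[n --> \oo] --> \oo) a b :
  (dim (a, b.+1) (q n))%:R / (dim (a.+1, b) (q n))%:R @[n --> \oo] --> (1 : R).
Proof.
have /cvgV : ((q n).1 - a)%N%:R / ((q n).1 + b).+2%:R @[n --> \oo] --> (1 : R).
  exact: cvg_shifted_quotient.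
rewrite invr1 => /(_ (oner_neq0 _)) upper.
have lower := cvg_shifted_quotient R _ a b q2.
apply: (squeeze_cvgr _ lower upper).
near=> n.
have D_gt0 : (0 < dim (a, b.+1) (q n))%N by near: n; exact: near_dim_gt0 q1 q2 _.
have D'_gt0 : (0 < dim (a.+1, b) (q n))%N by near: n; exact: near_dim_gt0 q1 q2 _.
have ltaq : (a < (q n).1)%N by near: n; move/cvgnyPgt : q1; exact.
have ltbq : (b < (q n).2)%N by near: n; move/cvgnyPgt : q2; exact.
move: D_gt0 D'_gt0 ltaq ltbq => /=; case: (q n) => i j /= D_gt0 D'_gt0 ltai ltbj.
apply/andP; split; rewrite ?invf_div ler_pdivrMr ?ltr0n // mulrAC;
  rewrite ler_pdivlMr ?ltr0n ?subn_gt0 // -!natrM ler_nat.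
  by rewrite [leqRHS]mulnC dim_neighbour_ratio //; lia.
rewrite mulnC (dim_sym a) (dim_sym a.+1).
by rewrite dim_neighbour_ratio //; lia.
Unshelve. all: by end_near.
Qed.

(** Telescoping from [(n, 0)] to [(n - c, c)] through neighbours. *)
Lemma cvg_level_ratio (R : realType) (q : nat -> vertex)
    (q1 : (q n).1 @[n --> \oo] --> \oo) (q2 : (q n).2 @[n --> \oo] --> \oo) n c :
  (c <= n)%N ->
  (dim ((n - c)%N, c) (q k))%:R / (dim (n, 0%N) (q k))%:R @[k --> \oo] --> (1 : R).
Proof.
elim: c => [_|c IHc ltcn].
  rewrite subn0; have : (1 : R) @[_ --> \oo : set_system nat] --> (1 : R).
    exact: cvg_cst.
  apply: cvg_trans; apply: near_eq_cvg.
  apply: filterS (near_dim_gt0 _ q1 q2 (n, 0%N)) => k D_gt0.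
  by rewrite divff // pnatr_eq0 -lt0n.
have lim1 := cvg_neighbour_ratio R _ q1 q2 (n - c.+1) c.
rewrite subnSK // in lim1.
have lim_mul := cvgM (FF := eventually_filter) lim1 (IHc (ltnW ltcn)).
rewrite mulr1 in lim_mul; apply: cvg_trans lim_mul; apply: near_eq_cvg.
apply: filterS (near_dim_gt0 _ q1 q2 ((n - c)%N, c)) => k D_gt0 /=.
by rewrite mulrA divfK // pnatr_eq0 -lt0n.
Qed.

(** Both path counts are divided by the one from [(n, 0)], where [n = a + b]:
    the numerator then tends to 1, and the denominator, expanded over the level
    of [(a, b)], to the number of paths from the root to that level. *)
Lemma cvg_dim_ratio (R : realType) (q : nat -> vertex)
    (q1 : (q n).1 @[n --> \oo] --> \oo) (q2 : (q n).2 @[n --> \oo] --> \oo) a b :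
  (dim (a, b) (q k))%:R / (dim graph_root (q k))%:R @[k --> \oo] -->
  ((\sum_(c < (a + b).+1) dim graph_root (a + b - c, nat_of_ord c)%N)%:R : R)^-1.
Proof.
set n := (a + b)%N.
pose x c (k : nat) : R := (dim ((n - c)%N, c) (q k))%:R / (dim (n, 0%N) (q k))%:R.
pose w c := dim graph_root ((n - c)%N, c).
have sum_cvg : \sum_(c < n.+1) (w c)%:R * x c k @[k --> \oo] -->
    ((\sum_(c < n.+1) w c)%:R : R).
  rewrite natr_sum; apply: cvg_big => [|c _]; first exact: add_continuous.
  rewrite -[X in _ --> X]mulr1.
  by apply: cvgMl_tmp; apply: (cvg_level_ratio R _ q1 q2); rewrite -ltnS.
have w_neq0 : (\sum_(c < n.+1) w c)%:R != 0 :> R.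
  rewrite pnatr_eq0 -lt0n (bigD1 ord0) //= /w subn0 addn_gt0.
  by rewrite (dim_gt0 0 0 n 0).
have xb1 : x b k @[k --> \oo] --> (1 : R).
  by apply: (cvg_level_ratio R _ q1 q2); exact: leq_addl.
have lim_inv := cvgV (FF := eventually_filter) w_neq0 sum_cvg.
have lim_div := cvgM (FF := eventually_filter) xb1 lim_inv.
rewrite mul1r in lim_div; apply: cvg_trans lim_div; apply: near_eq_cvg.
near=> k.
have D_neq0 : (dim (n, 0%N) (q k))%:R != 0 :> R.
  by rewrite pnatr_eq0 -lt0n; near: k; exact: near_dim_gt0 q1 q2 _.
have lenq : (n <= level (q k))%N.
  apply: leq_trans (leq_addr _ _); near: k; by move/cvgnyPge : q1; exact.
have root_sum : (dim graph_root (q k))%:R =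
    (\sum_(c < n.+1) (w c)%:R * x c k) * (dim (n, 0%N) (q k))%:R.
  rewrite (dim_via_level _ _ n) // natr_sum mulr_suml; apply: eq_bigr => c _.
  by rewrite natrM /x -mulrA divfK.
by rewrite /= root_sum invfM mulrA [x b k]/x addnK mulrAC.
Unshelve. all: by end_near.
Qed.

(** * Vertices of an infinite path *)

Lemma nondecreasing_unbounded_cvg (u : nat -> nat) :
  (forall n, u n <= u n.+1)%N -> unbounded u -> u n @[n --> \oo] --> \oo.
Proof.
move=> u_le u_unbounded; apply/cvgnyPge => A.
have u_homo := homo_leq leqnn leq_trans u_le.
have [N ltAN] := u_unbounded A.
apply: filterS (nbhs_infty_ge N) => n /u_homo; exact: leq_trans (ltnW ltAN).
Qed.

Lemma infinite_path_coord_le (e : nat -> arrow) n : infinite_path e ->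
  ((src (e n)).1 <= (src (e n.+1)).1)%N && ((src (e n)).2 <= (src (e n.+1)).2)%N.
Proof.
case=> _ e_edge eS; have := e_edge n; rewrite eS /is_edge /mult.
by case: eqP => [-> _|_]; last case: eqP => [-> _|//]; rewrite /= leqnn leqnSn.
Qed.

Theorem theorem1p1 (R : realType) (e : nat -> arrow)
    (e_path : infinite_path e)
    (i_unbounded : unbounded (fun n => (src (e n)).1))
    (j_unbounded : unbounded (fun n => (src (e n)).2)) :
  (forall P : vertex, cvgn (dim_ratio R P e)) /\
  (forall P Q : vertex, level P = level Q ->
     limn (dim_ratio R P e) = limn (dim_ratio R Q e)).
Proof.
have e1 : (src (e n)).1 @[n --> \oo] --> \oo.
  apply: nondecreasing_unbounded_cvg i_unbounded => n.
  by have /andP[] := infinite_path_coord_le e n e_path.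
have e2 : (src (e n)).2 @[n --> \oo] --> \oo.
  apply: nondecreasing_unbounded_cvg j_unbounded => n.
  by have /andP[] := infinite_path_coord_le e n e_path.
have ratio_cvg a b := cvg_dim_ratio R (fun n => src (e n)) e1 e2 a b.
split=> [[a b]|[a b] [c d]]; first by apply/cvg_ex; eexists; exact: ratio_cvg.
rewrite /level /= => eq_level.
have /cvg_lim -> := ratio_cvg a b; last exact: Rhausdorff.
have /cvg_lim -> := ratio_cvg c d; last exact: Rhausdorff.
by rewrite eq_level.
Qed.
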